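(* For every real $p>1$ and every real $m\ge0$ the following inequality holds: $$ I_p(m):=\frac{(p-1)\,m^{2(p-1)}}{\pi}\sum_{n\in\mathbb{Z}^2_0}\frac1{(m^2+|n|^2)^p}<1. $$
   Context: $\mathbb{Z}^2_0=\mathbb{Z}^2\setminus\{(0,0)\}$, and for $n=(n_1,n_2)\in\mathbb{Z}^2$, $|n|^2=n_1^2+n_2^2$. *)

(* Defs.v *)
From mathcomp Require Import all_boot all_order all_algebra.
From mathcomp Require Import all_classical all_reals all_analysis.

Set Implicit Arguments.
Unset Strict Implicit.
Unset Printing Implicit Defensive.

Import Order.TTheory GRing.Theory Num.Theory.

Local Open Scope classical_set_scope.
Local Open Scope ring_scope.

Definition Z20 : set (int * int) := [set n | n <> (0, 0)].

Definition sqnorm (n : int * int) : int := n.1 ^+ 2 + n.2 ^+ 2.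

(* The terms of the lattice sum are nonnegative, so it is taken as an unordered
   sum in the extended reals: [I_p p m < 1] for [m > 0] includes convergence of
   the series. *)
Definition I_p (R : realType) (p m : R) : \bar R :=
  (((p - 1) * m `^ (2 * (p - 1)) / pi)%:E *
   \esum_(n in Z20) (1 / (m ^+ 2 + (sqnorm n)%:~R) `^ p)%:E)%E.

(* Main.v *)
Require Import Defs.
From mathcomp Require Import all_boot all_order all_algebra.
From mathcomp Require Import all_classical all_reals all_analysis.
From mathcomp Require Import measurable_realfun ring lra.

Import Order.TTheory GRing.Theory Num.Theory.
Import numFieldNormedType.Exports.

Local Open Scope classical_set_scope.
Local Open Scope ring_scope.

(* Since [s^-p] is a multiple of the Laplace transform of [t^(p-1)] and
   [s^(1-p)/(p-1)] is the same multiple of that of [t^(p-2)], the inequality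
   follows by integration from the pointwise bound [theta(t)^2 - 1 < pi / t],
   where [theta(t)] is the sum of [e^(-t n^2)] over all integers [n].
   For [t >= 21/10] this is a comparison with a geometric series.  For smaller
   [t], the trapezoidal rule with mesh [h = sqrt t] for [f(x) = e^(-x^2)] has an
   error of at most [h^2/8] times the integral of the positive part of [f''],
   that is [h^2/8] times the maximum of [|f'|]; this is sharp enough because
   [sqrt (1 + pi/t) - sqrt (pi/t)] is also of order [sqrt t].
   Carrying the extra term [e^(-t)/100] along makes the final inequality
   strict for the supremum over finite partial sums. *)

(** * Monotonicity from the sign of the derivative, and primitives based at 0 *)

Lemma ler0_is_derive1_le (R : realType) (f df : R -> R) (a b : R) :
  a <= b -> {within `[a, b], continuous f} ->
  (forall x : R, a < x < b -> is_derive x 1 f (df x)) ->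
  (forall x, a < x < b -> df x <= 0) -> f b <= f a.
Proof.
move=> ab cf fdf df0.
apply: (@ler0_derive1_le_cc R f a b) => //; rewrite ?in_itv/= ?lexx ?ab//.
- by move=> x; rewrite in_itv/= => /fdf.
- move=> x; rewrite in_itv/= => xab; rewrite derive1E.
  by have [_ ->] := fdf _ xab; exact: df0.
Qed.

Definition primitive0 {R : realType} (g : R -> R) (x : R) : R :=
  parameterized_integral lebesgue_measure 0 x g.

Lemma primitive0_0 {R : realType} (g : R -> R) : primitive0 g 0 = 0.
Proof. by rewrite /primitive0 /parameterized_integral set_itv1 Rintegral_set1. Qed.

(** At 0 only a right limit is asked, because the lemma also serves for real powers x^q, which are
    meaningful only for x >= 0. *)
Lemma integrable_itv0 {R : realType} (g : R -> R) :
  (forall x : R, 0 < x -> {for x, continuous g}) -> g x @[x --> 0^'+] --> g 0 ->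
  forall b, lebesgue_measure.-integrable `[0, b] (EFin \o g).
Proof.
move=> gc g0 b; apply: continuous_compact_integrable; first exact: segment_compact.
have [b0|] := ltP 0 b.
  apply/(continuous_within_itvP _ b0); split => //.
    by move=> x; rewrite in_itv/= => /andP[x0 _]; exact: gc.
  by apply: cvg_at_left_filter; exact: gc.
rewrite le_eqVlt => /predU1P[->|b0].
  by rewrite set_itv1; exact: continuous_subspace1.
by rewrite set_itv_ge; [exact: continuous_subspace0|rewrite bnd_simp -ltNge].
Qed.

Lemma is_derive_primitive0 {R : realType} (g : R -> R) :
  (forall x : R, 0 < x -> {for x, continuous g}) -> g x @[x --> 0^'+] --> g 0 ->
  forall x : R, 0 < x -> is_derive x 1 (primitive0 g) (g x).
Proof.
move=> gc g0 x x0; have xx1 : x < x + 1 by rewrite ltrDl.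
have [dG <-] := @continuous_FTC1_closed R g 0 x (x + 1) xx1
  (integrable_itv0 g gc g0 _) x0 (gc _ x0).
by rewrite derive1E; exact/derivableP.
Qed.

Lemma continuous_primitive0 {R : realType} (g : R -> R) :
  (forall x : R, 0 < x -> {for x, continuous g}) -> g x @[x --> 0^'+] --> g 0 ->
  forall a b, 0 <= a -> {within `[a, b], continuous (primitive0 g)}.
Proof.
move=> gc g0 a b a0.
have [ab|ba] := leP a b; last first.
  by rewrite set_itv_ge; [exact: continuous_subspace0|rewrite bnd_simp -ltNge].
have := parameterized_integral_continuous (le_trans a0 ab) (integrable_itv0 g gc g0 b).
by apply: continuous_subspaceW; apply: subset_itvr; rewrite bnd_simp.
Qed.

(** * The trapezoidal rule for the gaussian *)

Lemma is_derive_gauss_fun {R : realType} (x : R) :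
  is_derive x 1 (gauss_fun) (- (2 * x) * gauss_fun x).
Proof.
rewrite /gauss_fun.
apply: is_derive_eq.
by rewrite /GRing.scale /=; ring.
Qed.

Lemma primitive0_gauss_le {R : realType} (x : R) :
  primitive0 (@gauss_fun R) x <= Num.sqrt pi / 2.
Proof.
rewrite -lee_fin -integral0y_gauss /primitive0 /parameterized_integral /Rintegral.
rewrite fineK; last first.
  apply: integrable_fin_num => //; apply: (integrable_itv0 gauss_fun).
    by move=> y _; exact: continuous_gauss_fun.
  by apply: cvg_at_right_filter; exact: continuous_gauss_fun.
apply: ge0_subset_integral => //=.
- by apply/measurable_EFinP/measurable_funTS; exact: measurable_gauss_fun.
- by move=> y _; rewrite lee_fin gauss_fun_ge0.
- exact: subset_itvl.
Qed.

Definition dgauss {R : realType} (x : R) : R := - (2 * x) * gauss_fun x.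

Lemma is_derive_dgauss {R : realType} (x : R) :
  is_derive x 1 (@dgauss R) ((4 * x ^+ 2 - 2) * gauss_fun x).
Proof.
rewrite /dgauss; have G := is_derive_gauss_fun x.
by apply: is_derive_eq; rewrite /GRing.scale /=; ring.
Qed.

(* With [q(x) = (x - a)(a + h - x) / 2] this is [q f' - q' f - F], where [F] is a
   primitive of [f]: its derivative is [q f''], and its increment over
   [[a, a + h]] is the error of the trapezoidal rule there. *)
Definition cell_remainder {R : realType} (a h x : R) : R :=
  (x - a) * (a + h - x) / 2 * dgauss x - (2 * a + h - 2 * x) / 2 * gauss_fun x
  - primitive0 gauss_fun x.

Lemma is_derive_cell_remainder {R : realType} (a h x : R) : 0 < x ->
  is_derive x 1 (cell_remainder a h)
    ((x - a) * (a + h - x) / 2 * ((4 * x ^+ 2 - 2) * gauss_fun x)).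
Proof.
move=> x0; have G := is_derive_gauss_fun x; have G' := is_derive_dgauss x.
have P : is_derive x 1 (primitive0 gauss_fun) (gauss_fun x).
  apply: is_derive_primitive0 => // [y _|]; first exact: continuous_gauss_fun.
  by apply: cvg_at_right_filter; exact: continuous_gauss_fun.
rewrite /cell_remainder; apply: is_derive_eq.
by rewrite /GRing.scale /= /dgauss; field.
Qed.

Lemma continuous_cell_remainder {R : realType} (a h x y : R) : 0 <= x ->
  {within `[x, y], continuous (cell_remainder a h)}.
Proof.
move=> x0 z; rewrite /cell_remainder; apply: cvgB.
  apply: (@continuous_subspaceT _ _ `[x, y] (fun x : R => (x - a) * (a + h - x) / 2 * dgauss x -
     (2 * a + h - 2 * x) / 2 * gauss_fun x)).
  move=> w; have G := is_derive_gauss_fun w; have G' := is_derive_dgauss w.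
  apply: differentiable_continuous; apply/derivable1_diffP; exact: ex_derive.
apply: continuous_primitive0 => // [w _|]; first exact: continuous_gauss_fun.
by apply: cvg_at_right_filter; exact: continuous_gauss_fun.
Qed.

(* The gaussian is concave up to [sqrt 2^-1] and convex afterwards, so this is a
   primitive of the positive part of its second derivative. *)
Definition dgauss_pos {R : realType} (x : R) : R :=
  dgauss (Num.max x (Num.sqrt 2^-1)).

(** The weight q of [cell_remainder] lies between 0 and h^2/8 on the cell, so the integral of q f''
    is at most h^2/8 times that of the positive part of f''. The cell is split at the inflection
    point [c]. *)
Lemma gauss_trapezoid_cell {R : realType} (a h : R) : 0 <= a -> 0 < h ->
  h / 2 * (gauss_fun a + gauss_fun (a + h)) <=
    primitive0 gauss_fun (a + h) - primitive0 gauss_fun a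
    + h ^+ 2 / 8 * (dgauss_pos (a + h) - dgauss_pos a).
Proof.
move=> a0 h0; set c : R := Num.sqrt 2^-1.
have c2 : c ^+ 2 = 2^-1 by rewrite sqr_sqrtr// invr_ge0.
have c0 : 0 <= c by exact: sqrtr_ge0.
(* Left of [c], f'' <= 0 and q >= 0, so the remainder decreases. *)
have conc x y : a <= x -> x <= y -> y <= a + h -> y <= c ->
    cell_remainder a h y <= cell_remainder a h x.
  move=> ax xy yah yc.
  apply: (@ler0_is_derive1_le _ _
    (fun z => (z - a) * (a + h - z) / 2 * ((4 * z ^+ 2 - 2) * gauss_fun z)) _ _ xy
    (continuous_cell_remainder _ _ _ _ (le_trans a0 ax))) => z /andP[xz zy].
    by apply: is_derive_cell_remainder; rewrite (le_lt_trans _ xz)// (le_trans a0).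
  rewrite mulr_ge0_le0//; first by rewrite divr_ge0// mulr_ge0//; lra.
  rewrite mulr_le0_ge0 ?gauss_fun_ge0//.
  have : z ^+ 2 <= c ^+ 2 by rewrite lerXn2r ?nnegrE//; lra.
  by rewrite c2; lra.
(* Right of [c], f'' >= 0 and q <= h^2/8, so the remainder minus h^2/8 f' decreases. *)
have conv x y : a <= x -> x <= y -> y <= a + h -> c <= x ->
    cell_remainder a h y - h ^+ 2 / 8 * dgauss y <=
    cell_remainder a h x - h ^+ 2 / 8 * dgauss x.
  move=> ax xy yah cx.
  apply: (@ler0_is_derive1_le _ (fun x => cell_remainder a h x - h ^+ 2 / 8 * dgauss x)
   (fun z => ((z - a) * (a + h - z) / 2 - h ^+ 2 / 8) * ((4 * z ^+ 2 - 2) * gauss_fun z)) _ _ xy).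
  - move=> z; apply: cvgB; first exact: (continuous_cell_remainder _ _ _ _ (le_trans a0 ax)).
    apply: (@continuous_subspaceT _ _ `[x, y] (fun x : R => h ^+ 2 / 8 * dgauss x)).
    move=> w; have G' := is_derive_dgauss w.
    by apply: differentiable_continuous; apply/derivable1_diffP; exact: ex_derive.
  - move=> z /andP[xz zy].
    have G' := is_derive_dgauss z.
    have G := is_derive_cell_remainder a h z (le_lt_trans (le_trans a0 ax) xz).
    by apply: is_derive_eq; rewrite /GRing.scale /=; ring.
  - move=> z /andP[xz zy].
    rewrite mulr_le0_ge0//; first by have := sqr_ge0 (a + h - z - (z - a)); lra.
    rewrite mulr_ge0 ?gauss_fun_ge0//.
    have : c ^+ 2 <= z ^+ 2 by rewrite lerXn2r ?nnegrE//; lra.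
    by rewrite c2; lra.
(* At both ends of the cell q vanishes, and only the terms q' f and F remain. *)
have -> : h / 2 * (gauss_fun a + gauss_fun (a + h)) =
    cell_remainder a h (a + h) - cell_remainder a h a
    + (primitive0 gauss_fun (a + h) - primitive0 gauss_fun a).
  by rewrite /cell_remainder; field.
rewrite addrC lerD2l.
rewrite /dgauss_pos -/c.
have aah : a <= a + h by lra.
have [ahc|cah] := leP (a + h) c.
  rewrite (max_idPr (le_trans aah ahc)) subrr mulr0 subr_le0.
  by apply: conc.
have [ac|ca] := leP a c.
  have := conc a c (lexx _) ac (ltW cah) (lexx _).
  have := conv c (a + h) ac (ltW cah) (lexx _) (lexx _).
  by lra.
have := conv a (a + h) (lexx _) aah (lexx _) (ltW ca).
by lra.
Qed.

(** The derivative corrections of the cells telescope. The node N h has weight h on the left but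
    only h/2 in the trapezoidal sum; the excess is moved to the right. *)
Lemma gauss_trapezoid {R : realType} (h : R) (N : nat) : 0 < h ->
  h * (2^-1 + \sum_(k < N) gauss_fun (k.+1%:R * h)) <=
    primitive0 gauss_fun (N%:R * h) + h / 2 * gauss_fun (N%:R * h)
    + h ^+ 2 / 8 * (dgauss_pos (N%:R * h) - dgauss_pos 0).
Proof.
move=> h0; elim: N => [|N IH].
  by rewrite big_ord0 mul0r primitive0_0 /gauss_fun expr0n/= oppr0 expR0; lra.
have := gauss_trapezoid_cell (N%:R * h) h (mulr_ge0 (ler0n _ _) (ltW h0)) h0.
rewrite big_ord_recr/= -[in X in X -> _](mul1r h).
have -> : N.+1%:R * h = N%:R * h + 1 * h by rewrite -mulrDl natr1.
by rewrite !mul1r; lra.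
Qed.

(** The maximum of |f'|, attained at the inflection point; it equals sqrt (2/e). *)
Definition dgauss_max {R : realType} : R := 2 * Num.sqrt 2^-1 * expR (- 2^-1).

(** Extending the sum to K >= N nodes only increases it. Twice the trapezoidal bound for K nodes
    then has the excess h f(K h), which vanishes as K grows. *)
Lemma gauss_sum_le {R : realType} (h : R) (N : nat) : 0 < h ->
  h * (1 + 2 * \sum_(k < N) gauss_fun (k.+1%:R * h)) <=
    Num.sqrt pi + h ^+ 2 / 4 * dgauss_max.
Proof.
move=> h0.
have d0 : dgauss_pos 0 = - @dgauss_max R.
  rewrite /dgauss_pos (max_idPr _) ?sqrtr_ge0// /dgauss /gauss_fun sqr_sqrtr ?invr_ge0//.
  by rewrite /dgauss_max; ring.
have dx x : @dgauss_pos R x <= 0.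
  rewrite /dgauss_pos /dgauss mulr_le0_ge0 ?gauss_fun_ge0// oppr_le0 mulr_ge0//.
  by rewrite le_max sqrtr_ge0 orbT.
have bound K : (N <= K)%N -> h * (1 + 2 * \sum_(k < N) gauss_fun (k.+1%:R * h)) <=
    Num.sqrt pi + h ^+ 2 / 4 * dgauss_max + h * gauss_fun (K%:R * h).
  move=> NK; have := gauss_trapezoid h K h0.
  have := primitive0_gauss_le (K%:R * h).
  have : \sum_(k < N) gauss_fun (k.+1%:R * h) <= \sum_(k < K) gauss_fun (k.+1%:R * h).
    rewrite -!(big_mkord xpredT (fun k => gauss_fun (k.+1%:R * h))).
    rewrite (big_cat_nat (leq0n N) NK)//= lerDl sumr_ge0// => i _; exact: gauss_fun_ge0.
  move=> /(ler_wpM2l (ltW h0)).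
  have := ler_wpM2l (sqr_ge0 h) (dx (K%:R * h)).
  by rewrite d0; lra.
have cv : (Num.sqrt pi + h ^+ 2 / 4 * dgauss_max + h * gauss_fun (K%:R * h))
    @[K --> \oo] --> Num.sqrt pi + h ^+ 2 / 4 * dgauss_max + h * 0.
  apply: cvgD; first exact: cvg_cst.
  apply: cvgM; first exact: cvg_cst.
  apply: (@cvg_comp _ _ _ (GRing.natmul 1) (fun x => gauss_fun (x * h)) _ _ _ cvgr_idn).
  exact: (@cvg_comp _ _ _ ( *%R^~ h) _ _ _ _ (gt0_cvgMly h0 cvg_id) cvg_gauss_fun).
rewrite mulr0 addr0 in cv.
apply: ler_cvg_to (cvg_cst _) cv _.
by near=> K; apply: bound; near: K; exact: nbhs_infty_ge.
Unshelve. all: by end_near. Qed.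

Lemma dgauss_max_sqr {R : realType} : (@dgauss_max R) ^+ 2 <= 77 / 100.
Proof.
have e1 : 13 / 5 <= expR 1 :> R.
  (* (1 + 1/16)^16 is about 2.64, and it is below e by 1 + x <= e^x at x = 1/16. *)
  apply: (@le_trans _ _ ((17 / 16) ^+ 16)); first by lra.
  rewrite -[X in expR X](@mulfV _ 16)// expRM_natl lerXn2r// ?nnegrE ?expR_ge0//.
  by apply: le_trans (expR_ge1Dx _); lra.
have -> : (@dgauss_max R) ^+ 2 = 2 * expR (-1).
  rewrite /dgauss_max !exprMn sqr_sqrtr ?invr_ge0// -expRM_natl mulrN divff//.
  by rewrite expr2; lra.
by rewrite expRN ler_pdivrMr ?expR_gt0//; lra.
Qed.

(** * The pointwise bound on theta(t)^2, for large and for small t *)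

Lemma sinh_ge_id {R : realType} (x : R) : 0 <= x -> 2 * x <= expR x - expR (- x).
Proof.
move=> x0; rewrite -subr_le0.
have -> : 0 = 2 * 0 - (expR 0 - expR (- 0)) :> R by rewrite oppr0; lra.
apply: (@ler0_is_derive1_le _ (fun x => 2 * x - (expR x - expR (- x)))
  (fun x => 2 - (expR x + expR (- x))) _ _ x0).
- apply: (@continuous_subspaceT _ _ `[0, x] (fun x : R => 2 * x - (expR x - expR (- x)))).
  by move=> y; apply: differentiable_continuous; apply/derivable1_diffP; exact: ex_derive.
- by move=> y _; apply: is_derive_eq; rewrite /GRing.scale /=; ring.
- by move=> y _; have := expR_ge1Dx y; have := expR_ge1Dx (- y); lra.
Qed.

(** As k^2 >= k, each term is at most e^(-t k), and the products e^(-t k) (e^t - 1) telescope. *)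
Lemma theta_geometric {R : realType} (t : R) (N : nat) : 0 < t ->
  (\sum_(k < N) expR (- (t * k.+1%:R ^+ 2))) * (expR t - 1) <= 1 - expR (- (t * N%:R)).
Proof.
move=> t0; elim: N => [|N IH].
  by rewrite big_ord0 mul0r mulr0 oppr0 expR0 subrr.
rewrite big_ord_recr/= mulrDl.
have E0 : 0 <= expR t - 1 by rewrite subr_ge0 ltW// pexpR_gt1.
have h : expR (- (t * N.+1%:R ^+ 2)) <= expR (- (t * N.+1%:R)).
  rewrite ler_expR lerN2 ler_pM2l// ler_eXnr// ?ler1n//.
have e : expR (- (t * N.+1%:R)) * expR t = expR (- (t * N%:R)).
  by rewrite -expRD -natr1; congr expR; ring.
have := ler_wpM2r E0 h; rewrite [leRHS]mulrBr e; lra.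
Qed.

(** With S the sum, the claim is 4 t S (S + 1) + t e^(-t) / 100 <= pi. From S (S + 1) t^2 <= 1 and t
    >= 21/10 the first term is at most 40/21, the second at most 1/100, and pi >= 2. *)
Lemma theta_large {R : realType} (t : R) (N : nat) : 21 / 10 <= t ->
  (1 + 2 * \sum_(k < N) expR (- (t * k.+1%:R ^+ 2))) ^+ 2 + expR (- t) / 100 <= 1 + pi / t.
Proof.
move=> t1; have t0 : 0 < t by lra.
set S := \sum_(_ < _) _.
have S0 : 0 <= S by apply: sumr_ge0 => i _; exact: expR_ge0.
have h1 : S * (expR t - 1) <= 1.
  by have := theta_geometric t N t0; have := expR_ge0 (- (t * N%:R)); rewrite -/S; lra.
have := sinh_ge_id (t / 2) (ltW (divr_gt0 t0 (ltr0Sn _ 1))).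
rewrite mulrC divfK//.
(* Here [d] is 2 sinh (t/2), so that t <= d and e^t - 1 = y d. *)
set y := expR (t / 2); set d := y - _ => td.
have y0 : 0 < y by exact: expR_gt0.
have yd : y * d = y ^+ 2 - 1 by rewrite /d mulrBr expRxMexpNx_1 expr2.
have y2 : expR t = y ^+ 2 by rewrite -expRM_natl mulrC divfK.
have d0 : 0 < d by lra.
have h2 : (S + 1) * d <= y.
  rewrite -(ler_pM2l y0) mulrCA yd -y2; move: h1; rewrite y2; lra.
have h3 : S * d * y <= 1 by move: h1; rewrite y2 -yd; lra.
(* The geometric bound amounts to [4 S (S + 1) <= (sinh (t / 2))^-2]. *)
have h4 : S * (S + 1) * d ^+ 2 <= 1.
  apply: le_trans h3; rewrite expr2 mulrACA ler_wpM2l// mulr_ge0//; exact: ltW.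
have h5 : S * (S + 1) * t ^+ 2 <= 1.
  apply: le_trans h4; rewrite ler_wpM2l//; first by rewrite mulr_ge0//; lra.
  by rewrite lerXn2r ?nnegrE//; lra.
have e1 : expR (- t) * t <= 1.
  rewrite expRN mulrC ler_pdivrMr ?expR_gt0// mul1r.
  by have := expR_ge1Dx t; lra.
have p2 := @pi_ge2 R.
rewrite -(ler_pM2r t0) [leRHS]mulrDl mul1r divfK ?gt_eqF//.
have h6 : S * (S + 1) * t <= 10 / 21.
  have : 0 <= S * (S + 1) * t * (t - 21 / 10) by rewrite !mulr_ge0//; lra.
  by move: h5; rewrite expr2; lra.
by rewrite expr2; lra.
Qed.

(** For h = sqrt t, [gauss_sum_le] reads sqrt t * u <= sqrt pi + t M / 4. Squaring leaves pi + t
    (sqrt pi * M / 2 + t M^2 / 16), where the bracket must stay below 1 with some room. *)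
Lemma theta_small {R : realType} (t : R) (N : nat) : 0 < t -> t <= 21 / 10 ->
  (1 + 2 * \sum_(k < N) expR (- (t * k.+1%:R ^+ 2))) ^+ 2 + expR (- t) / 100 <= 1 + pi / t.
Proof.
move=> t0 t1; set h := Num.sqrt t.
have h0 : 0 < h by rewrite sqrtr_gt0.
have h2 : h ^+ 2 = t by rewrite sqr_sqrtr// ltW.
have := gauss_sum_le h N h0.
have -> : \sum_(k < N) gauss_fun (k.+1%:R * h) = \sum_(k < N) expR (- (t * k.+1%:R ^+ 2)).
  by apply: eq_bigr => k _; rewrite /gauss_fun exprMn h2 mulrC.
set u := 1 + _; rewrite h2.
set r := Num.sqrt pi; set M := dgauss_max => H.
have u0 : 0 <= u.
  by rewrite addr_ge0// mulr_ge0// sumr_ge0// => i _; exact: expR_ge0.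
have r0 : 0 <= r by exact: sqrtr_ge0.
have r2 : r ^+ 2 = pi by rewrite sqr_sqrtr// pi_ge0.
have M0 : 0 <= M by rewrite /M /dgauss_max !mulr_ge0// ?sqrtr_ge0 ?expR_ge0.
have M2 : M ^+ 2 <= 77 / 100 := dgauss_max_sqr.
(* Already pi <= 4 gives (r M)^2 <= 3.08 < (44/25)^2. *)
have p4 : pi <= 4 :> R by have := @pihalf_lt2 R; lra.
have rM : r * M <= 44 / 25.
  rewrite -(@ler_pXn2r _ 2) ?nnegrE ?mulr_ge0// exprMn r2.
  have : 0 <= (4 - pi) * M ^+ 2 by rewrite mulr_ge0 ?sqr_ge0//; lra.
  by lra.
have e1 : expR (- t) <= 1 by rewrite -expR0 ler_expR; lra.
have H2 : t * u ^+ 2 <= (r + t / 4 * M) ^+ 2.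
  by rewrite -h2 -exprMn lerXn2r ?nnegrE// ?addr_ge0// ?mulr_ge0// ?(ltW h0)//; rewrite h2; lra.
rewrite -(ler_pM2l t0) [leRHS]mulrDr mulrCA divff ?gt_eqF// !mulr1 mulrDr.
(* The cross term contributes at most 0.88 t and the last square at most 0.102 t; the remaining t /
   100 absorbs the exponential. *)
have H3 : (r + t / 4 * M) ^+ 2 <= pi + t * (99 / 100).
  rewrite sqrrD r2 -[X in pi + X + _]mulr_natl.
  have : t * (r * M) <= t * (44 / 25) by rewrite ler_pM2l.
  have : t * (t * M ^+ 2) <= t * (21 / 10 * (77 / 100)).
    by rewrite ler_pM2l// ler_pM// ?sqr_ge0// ltW.
  by move=> ? ?; nra.
have : t * expR (- t) <= t * 1 by rewrite ler_pM2l.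
by lra.
Qed.

Lemma theta_le {R : realType} (t : R) (N : nat) : 0 < t ->
  (1 + 2 * \sum_(k < N) expR (- (t * k.+1%:R ^+ 2))) ^+ 2 + expR (- t) / 100 <= 1 + pi / t.
Proof.
move=> t0; have [/theta_small|/ltW /theta_large] := leP t (21 / 10); first exact.
exact.
Qed.

(** * The Gamma integrand and its truncated integral *)

Definition gamma_fun {R : realType} (q x : R) : R := x `^ q * expR (- x).

Lemma powR_expR_cvg0 {R : realType} (q s : R) : 0 < q ->
  x `^ q * expR (- (s * x)) @[x --> 0^'+] --> 0 `^ q * expR (- (s * 0)).
Proof.
move=> q0; rewrite powR0 ?gt_eqF//; apply: cvgM; first exact: powR_cvg0.
apply: cvg_at_right_filter.
suff : {for 0, continuous (fun x : R => expR (- (s * x)))} by [].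
apply: differentiable_continuous; apply/derivable1_diffP; exact: ex_derive.
Qed.

Lemma is_derive_powR_expR {R : realType} (q s x : R) : 0 < x ->
  is_derive x 1 (fun x => x `^ q * expR (- (s * x)))
    (q * x `^ (q - 1) * expR (- (s * x)) - s * (x `^ q * expR (- (s * x)))).
Proof.
move=> x0; have D := is_derive1_powR q x0.
by apply: is_derive_eq; rewrite /GRing.scale /=; ring.
Qed.

Lemma gamma_fun_continuous {R : realType} (q x : R) : 0 < x -> {for x, continuous (gamma_fun q)}.
Proof.
move=> x0; rewrite /gamma_fun; have D := is_derive1_powR q x0.
apply: differentiable_continuous; apply/derivable1_diffP; exact: ex_derive.
Qed.

Lemma gamma_fun_cvg0 {R : realType} (q : R) : 0 < q ->
  gamma_fun q x @[x --> 0^'+] --> gamma_fun q 0.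
Proof.
move=> q0; have := powR_expR_cvg0 q 1 q0; rewrite mul1r.
by under eq_fun do rewrite mul1r.
Qed.

(** Raising x / (2 q) <= e^(x / (2 q)) to the power q gives x^q <= (2 q)^q e^(x / 2), so half of the
    exponential decay survives. *)
Lemma powR_expR_le {R : realType} (q x : R) : 0 < q -> 0 <= x ->
  gamma_fun q x <= (2 * q) `^ q * expR (- (x / 2)).
Proof.
move=> q0 x0; rewrite /gamma_fun.
have -> : expR (- x) = expR (- (x / 2)) * expR (- (x / 2)).
  by rewrite -expRD; congr expR; field.
rewrite mulrA ler_wpM2r ?expR_ge0//.
rewrite expRN ler_pdivrMr ?expR_gt0//.
have -> : x / 2 = x / (2 * q) * q by field; rewrite gt_eqF.
rewrite expRM -powRM ?expR_ge0 ?mulr_ge0 ?(ltW q0)//.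
apply: ge0_ler_powR; rewrite ?nnegrE ?mulr_ge0 ?expR_ge0 ?(ltW q0)//.
rewrite mulrC -ler_pdivrMr ?mulr_gt0//.
by have := expR_ge1Dx (x / (2 * q)); lra.
Qed.

(** The lower incomplete Gamma function of parameter q + 1, equal to 0 on the negative axis, where
    the interval of integration is empty. *)
Definition gamma_low {R : realType} (q : R) : R -> R := primitive0 (gamma_fun q).

Lemma is_derive_gamma_low {R : realType} (q x : R) : 0 < q -> 0 < x ->
  is_derive x 1 (gamma_low q) (gamma_fun q x).
Proof.
move=> q0; apply: is_derive_primitive0 (gamma_fun_cvg0 q q0) _.
by move=> y; exact: gamma_fun_continuous.
Qed.

Lemma gamma_low_within {R : realType} (q a b : R) : 0 < q -> 0 <= a ->
  {within `[a, b], continuous (gamma_low q)}.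
Proof.
move=> q0; apply: continuous_primitive0 (gamma_fun_cvg0 q q0) _ _.
by move=> y; exact: gamma_fun_continuous.
Qed.

Lemma gamma_low_le0 {R : realType} (q x : R) : x <= 0 -> gamma_low q x = 0.
Proof.
rewrite le_eqVlt => /predU1P[->|x0]; first exact: primitive0_0.
rewrite /gamma_low /primitive0 /parameterized_integral set_itv_ge ?Rintegral_set0//.
by rewrite bnd_simp -ltNge.
Qed.

Lemma gamma_low_continuous {R : realType} (q : R) : 0 < q -> continuous (gamma_low q).
Proof.
move=> q0 x; have [x0|x0|->] := ltgtP x 0; last 1 first.
- apply/left_right_continuousP; split.
    rewrite gamma_low_le0//; apply: cvg_near_cst; near=> y.
    by apply: gamma_low_le0; near: y; exact: nbhs_left_le.
  by have /(continuous_within_itvP _ ltr01)[] := gamma_low_within q 0 1 q0 (lexx 0).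
- rewrite /continuous_at gamma_low_le0 ?ltW//; apply: cvg_near_cst; near=> y.
  by apply: gamma_low_le0; apply: ltW; near: y; exact: lt_nbhsl.
- have D := is_derive_gamma_low q x q0 x0.
  by apply: differentiable_continuous; apply/derivable1_diffP; exact: ex_derive.
Unshelve. all: by end_near. Qed.

Lemma gamma_low_ndecr {R : realType} (q : R) : 0 < q -> {homo gamma_low q : x y / x <= y}.
Proof.
move=> q0 x y xy; have [x0|/ltW x0] := leP x 0.
  rewrite gamma_low_le0//; apply: Rintegral_ge0 => v _.
  by rewrite mulr_ge0 ?powR_ge0 ?expR_ge0.
rewrite -lerN2.
apply: (@ler0_is_derive1_le _ (fun v => - gamma_low q v) (fun v => - gamma_fun q v) _ _ xy).
- by move=> z; apply: cvgN; exact: gamma_low_within.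
- move=> z /andP[xz _]; have D := is_derive_gamma_low q z q0 (le_lt_trans x0 xz).
  exact: is_deriveN.
- by move=> z _; rewrite oppr_le0 mulr_ge0 ?powR_ge0 ?expR_ge0.
Qed.

(** The integrand is at most C e^(-v / 2), whose integral over the half line is 2 C. *)
Lemma gamma_low_bounded {R : realType} (q x : R) : 0 < q ->
  gamma_low q x <= 2 * (2 * q) `^ q.
Proof.
move=> q0; have C0 := powR_ge0 (2 * q) q; set C := _ `^ _ in C0 *.
have [x0|/ltW x0] := leP x 0; first by rewrite gamma_low_le0//; lra.
suff : gamma_low q x + 2 * C * expR (- (x / 2)) <= 2 * C.
  by have := mulr_ge0 C0 (expR_ge0 (- (x / 2))); lra.
rewrite [leRHS](_ : _ = gamma_low q 0 + 2 * C * expR (- (0 / 2))); last first.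
  by rewrite gamma_low_le0// mul0r oppr0 expR0; ring.
apply: (@ler0_is_derive1_le _ (fun v => gamma_low q v + 2 * C * expR (- (v / 2)))
  (fun v => gamma_fun q v - C * expR (- (v / 2))) _ _ x0).
- move=> z; apply: cvgD; first exact: gamma_low_within.
  apply: (@continuous_subspaceT _ _ `[0, x] (fun v : R => 2 * C * expR (- (v / 2)))).
  move=> y; apply: differentiable_continuous; apply/derivable1_diffP; exact: ex_derive.
- move=> z /andP[z0 _]; have D := is_derive_gamma_low q z q0 z0.
  by apply: is_derive_eq; rewrite /GRing.scale /=; field.
- by move=> z /andP[z0 _]; rewrite subr_le0; apply: powR_expR_le => //; exact: ltW.
Qed.

Lemma gamma_low_cvg {R : realType} (q : R) : 0 < q ->
  exists2 L : R, 0 < L & gamma_low q x @[x --> +oo] --> L.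
Proof.
move=> q0.
have ub : has_ubound (range (gamma_low q)).
  by exists (2 * (2 * q) `^ q) => _ [x _ <-]; exact: gamma_low_bounded.
exists (sup (range (gamma_low q))); last exact: nondecreasing_cvgr (gamma_low_ndecr q q0) ub.
apply: (@lt_le_trans _ _ (gamma_low q 2)); last by apply: ub_le_sup => //; exists 2.
have g1 : 0 <= gamma_low q 1 by rewrite -(gamma_low_le0 q 0 (lexx _)) gamma_low_ndecr.
have e12 : expR (- 2) < expR (- 1) :> R by rewrite ltr_expR; lra.
(* On [1, 2] the power v^q is at least 1, so the integral there is at least e^(-1) - e^(-2) > 0. *)
suff : - gamma_low q 2 - expR (- 2) <= - gamma_low q 1 - expR (- 1) by lra.
apply: (@ler0_is_derive1_le _ (fun v => - gamma_low q v - expR (- v))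
  (fun v => - gamma_fun q v + expR (- v)) 1 2); first by lra.
- move=> z; apply: cvgB; first by apply: cvgN; exact: gamma_low_within.
  suff : {within `[1, 2], continuous (fun v : R => expR (- v))} by exact.
  apply: continuous_subspaceT => y; apply: differentiable_continuous.
  by apply/derivable1_diffP; exact: ex_derive.
- move=> z /andP[z1 _].
  have D := is_derive_gamma_low q z q0 (lt_trans ltr01 z1).
  by apply: is_derive_eq; rewrite /GRing.scale /=; ring.
- move=> z /andP[z1 _]; rewrite addrC subr_le0 /gamma_fun ler_peMl ?expR_ge0//.
  by rewrite -[leLHS](powRr0 z) ler_powR// ltW.
Qed.

Lemma powR_expR_cvgy {R : realType} (q s : R) : 0 < q -> 0 < s ->
  x `^ q * expR (- (s * x)) @[x --> +oo] --> 0.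
Proof.
move=> q0 s0.
have C0 : (s^-1 `^ q * (2 * q) `^ q) * expR (- (s / 2 * x)) @[x --> +oo]
    --> (s^-1 `^ q * (2 * q) `^ q) * 0.
  apply: cvgM; first exact: cvg_cst.
  rewrite (_ : (fun x => expR (- (s / 2 * x))) =
    (fun x : R => expR (- x)) \o ( *%R^~ (s / 2))); last first.
    by apply/funext => x /=; rewrite mulrC.
  exact: cvg_comp (gt0_cvgMly (divr_gt0 s0 (ltr0Sn _ 1)) cvg_id) (@cvgr_expR R).
rewrite mulr0 in C0.
apply: (squeeze_cvgr _ (cvg_cst 0) C0).
near=> x; have x0 : 0 <= x by near: x; exact: nbhs_pinfty_ge.
rewrite mulr_ge0 ?powR_ge0 ?expR_ge0//=.
have := powR_expR_le q (s * x) q0 (mulr_ge0 (ltW s0) x0).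
rewrite /gamma_fun powRM ?(ltW s0)//.
have sq : s^-1 `^ q * s `^ q = 1.
  by rewrite -powRM ?invr_ge0 ?(ltW s0)// mulVf ?gt_eqF// powR1.
move=> /(ler_wpM2l (powR_ge0 s^-1 q)).
by rewrite !mulrA sq mul1r [s * x / 2]mulrAC.
Unshelve. all: by end_near. Qed.

(** * Comparison of Laplace transforms *)

Lemma is_derive_big_seq {R : realType} (I : eqType) (r : seq I) (F : I -> R -> R)
  (dF : I -> R) (x : R) : (forall i, i \in r -> is_derive x 1 (F i) (dF i)) ->
  is_derive x 1 (fun y => \sum_(i <- r) F i y) (\sum_(i <- r) dF i).
Proof.
elim: r => [_|i r IH dF_r].
  rewrite big_nil; under eq_fun do rewrite big_nil; exact: is_derive_cst.
rewrite big_cons; under eq_fun do rewrite big_cons.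
apply: is_deriveD; first by apply: dF_r; rewrite mem_head.
by apply: IH => j jr; apply: dF_r; rewrite in_cons jr orbT.
Qed.

Lemma cvg_big_seq {R : realType} (I : Type) (r : seq I) (F : I -> R -> R) (l : I -> R)
  (G : set_system R) : Filter G -> (forall i, F i x @[x --> G] --> l i) ->
  \sum_(i <- r) F i x @[x --> G] --> \sum_(i <- r) l i.
Proof. by move=> FG Fl; apply: cvg_big => //; exact: add_continuous. Qed.

(** For a > 0 and x >= 0 this is the integral of v^q e^(-a v) over [0, x], after the substitution of
    a v for the variable. *)
Definition gamma_scaled {R : realType} (q a x : R) : R :=
  a `^ (- (q + 1)) * gamma_low q (a * x).

Lemma is_derive_gamma_scaled {R : realType} (q a x : R) : 0 < q -> 0 < a -> 0 < x ->
  is_derive x 1 (gamma_scaled q a) (x `^ q * expR (- (a * x))).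
Proof.
move=> q0 a0 x0; have ax0 := mulr_gt0 a0 x0.
have D := is_derive_gamma_low q (a * x) q0 ax0.
have D' : is_derive x 1 ( *%R a) a.
  by apply: is_derive_eq; rewrite /GRing.scale /= !mulr1 ?mulr0 ?addr0 ?add0r.
have D'' := is_derive1_comp D D'.
rewrite /gamma_scaled.
suff -> : x `^ q * expR (- (a * x)) = a `^ (- (q + 1)) * (gamma_fun q (a * x) * a).
  apply: is_deriveZ.
rewrite /gamma_fun powRM ?ltW// powRN.
have -> : a `^ (q + 1) = a `^ q * a by rewrite powRD ?(gt_eqF a0) ?implybT// powRr1// ltW.
field. by rewrite !gt_eqF// powR_gt0.
Qed.

Lemma gamma_scaled_continuous {R : realType} (q a : R) : 0 < q ->
  continuous (gamma_scaled q a).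
Proof.
move=> q0 x; apply: cvgM; first exact: cvg_cst.
apply: (@continuous_comp _ _ _ ( *%R a) (gamma_low q)); first exact: mulrl_continuous.
exact: gamma_low_continuous.
Qed.

(* The difference of the two sides, with the Laplace integrals truncated at [T],
   has a nonpositive derivative in [T] once the boundary term
   [k / q * T^q * e^(-s T)] is added to the right one; let [T] tend to infinity. *)
Lemma laplace_le {R : realType} (q k s : R) (r : seq (R * R)) : 0 < q -> 0 < s ->
  (forall x, x \in r -> 0 < x.2) ->
  (forall t, 0 < t ->
     \sum_(x <- r) x.1 * expR (- (x.2 * t)) <= k / t * expR (- (s * t))) ->
  \sum_(x <- r) x.1 * x.2 `^ (- (q + 1)) <= k / q * s `^ (- q).
Proof.
move=> q0 s0 r0 H.
(* Integration by parts replaces k times the integral of t^(q-1) e^(-s t), whose integrand blows up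
   at 0 if q < 1, by [k * s / q] times that of t^q e^(-s t) plus the boundary term [B]. *)
pose A T := \sum_(x <- r) x.1 * gamma_scaled q x.2 T - (k * s / q) * gamma_scaled q s T.
pose B T := (k / q) * (T `^ q * expR (- (s * T))).
have cA : continuous A.
  move=> x; apply: cvgB; last by apply: cvgM; [exact: cvg_cst|exact: gamma_scaled_continuous].
  apply: cvg_big_seq => i; apply: cvgM; [exact: cvg_cst|exact: gamma_scaled_continuous].
have A0 : A 0 = 0.
  rewrite /A /gamma_scaled big1 ?mulr0 ?gamma_low_le0 ?mulr0 ?subr0// => i _.
  by rewrite mulr0 gamma_low_le0// !mulr0.
have B0 : B 0 = 0 by rewrite /B powR0 ?gt_eqF// mul0r mulr0.
have AB (T : R) : 0 < T -> A T <= B T.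
  move=> T0; rewrite -subr_le0.
  have -> : 0 = A 0 - B 0 by rewrite A0 B0 subrr.
  apply: (@ler0_is_derive1_le _ (fun T => A T - B T) (fun x =>
    \sum_(i <- r) i.1 * (x `^ q * expR (- (i.2 * x)))
      - (k * s / q) * (x `^ q * expR (- (s * x)))
    - (k / q) * (q * x `^ (q - 1) * expR (- (s * x)) - s * (x `^ q * expR (- (s * x)))))
    0 T (ltW T0)).
  - move=> z; apply: cvgB; first exact: (continuous_subspaceT cA).
    suff : {within `[0, T], continuous B} by exact.
    apply/(continuous_within_itvP _ T0); split.
    + move=> x; rewrite in_itv/= => /andP[x0 _].
      have D := is_derive_powR_expR q s x x0.
      by apply: differentiable_continuous; apply/derivable1_diffP; exact: ex_derive.
    + by apply: cvgM; [exact: cvg_cst|exact: powR_expR_cvg0].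
    + have D := is_derive_powR_expR q s T T0.
      apply: cvg_at_left_filter.
      suff : {for T, continuous B} by [].
      by apply: differentiable_continuous; apply/derivable1_diffP; exact: ex_derive.
  - move=> x /andP[x0 _].
    have D := is_derive_powR_expR q s x x0.
    have D1 := is_derive_gamma_scaled q s x q0 s0 x0.
    have D2 := is_derive_big_seq _ r (fun i T => i.1 * gamma_scaled q i.2 T) _ x
      (fun i ir => is_deriveZ i.1 (is_derive_gamma_scaled q i.2 x q0 (r0 _ ir) x0)).
    exact: is_deriveB.
  - move=> x /andP[x0 _].
    have -> : x `^ (q - 1) = x `^ q / x by rewrite powRB ?powRr1 ?(ltW x0)// (gt_eqF x0) implybT.
    have -> : \sum_(i <- r) i.1 * (x `^ q * expR (- (i.2 * x))) =
        x `^ q * \sum_(i <- r) i.1 * expR (- (i.2 * x)).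
      by rewrite mulr_sumr; apply: eq_bigr => i _; rewrite mulrCA.
    have -> : \sum_(i <- r) i.1 * expR (- (i.2 * x)) =
      \sum_(i <- r) i.1 * expR (- (i.2 * x)) - k / x * expR (- (s * x))
       + k / x * expR (- (s * x)) by rewrite subrK.
    have := H _ x0; rewrite -subr_le0; set S := _ - _ => S0.
    (* The two terms in k s / q cancel, and what remains is x^q times the difference of the two
       sides of the hypothesis. *)
    rewrite [leLHS](_ : _ = x `^ q * S); first by rewrite mulr_ge0_le0// powR_ge0.
    by field; rewrite !gt_eqF.
(* L is Gamma(q + 1), a positive factor common to both sides in the limit, which cancels at the
   end. *)
have [L L0 cL] := gamma_low_cvg q q0.
have cgs a : 0 < a -> gamma_scaled q a x @[x --> +oo] --> a `^ (- (q + 1)) * L.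
  move=> a0; apply: cvgM; first exact: cvg_cst.
  rewrite (_ : (fun x => gamma_low q (a * x)) = gamma_low q \o ( *%R^~ a)); last first.
    by apply/funext => x /=; rewrite mulrC.
  exact: cvg_comp (gt0_cvgMly a0 cvg_id) cL.
have cAl : A x @[x --> +oo] -->
    \sum_(x <- r) x.1 * (x.2 `^ (- (q + 1)) * L) - k * s / q * (s `^ (- (q + 1)) * L).
  apply: cvgB; last by apply: cvgM; [exact: cvg_cst|exact: cgs].
  under eq_fun do rewrite big_seq; rewrite big_seq.
  apply: cvg_big => [|i /r0 i0]; first exact: add_continuous.
  by apply: cvgM; [exact: cvg_cst|exact: cgs].
have cBl : B x @[x --> +oo] --> k / q * 0.
  by apply: cvgM; [exact: cvg_cst|exact: powR_expR_cvgy].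
have : \sum_(x <- r) x.1 * (x.2 `^ (- (q + 1)) * L) - k * s / q * (s `^ (- (q + 1)) * L)
    <= k / q * 0.
  apply: ler_cvg_to cAl cBl _.
  by near=> T; apply: AB; near: T; exact: nbhs_pinfty_gt.
have -> : \sum_(x <- r) x.1 * (x.2 `^ (- (q + 1)) * L) =
    (\sum_(x <- r) x.1 * x.2 `^ (- (q + 1))) * L.
  by rewrite mulr_suml; apply: eq_bigr => i _; rewrite mulrA.
have -> : k * s / q * (s `^ (- (q + 1)) * L) = k / q * s `^ (- q) * L.
  have -> : s `^ (- q) = s `^ (- (q + 1)) * s.
    rewrite -[X in _ * X](@powRr1 _ s) ?(ltW s0)// -powRD ?(gt_eqF s0) ?implybT//.
    by congr powR; ring.
  by ring.
by rewrite mulr0 -mulrBl pmulr_lle0// subr_le0.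
Unshelve. all: by end_near. Qed.

(** * Finite lattice sums and the conclusion *)

Lemma ler_sum_subseq {R : realType} (I : eqType) (r s : seq I) (F : I -> R) :
  uniq r -> uniq s -> {subset r <= s} -> (forall i, 0 <= F i) ->
  \sum_(i <- r) F i <= \sum_(i <- s) F i.
Proof.
move=> ur us rs F0; rewrite (bigID (mem r) (r := s))/= -[leLHS]addr0 lerD ?sumr_ge0//.
rewrite -[leRHS]big_filter (perm_big [seq i <- s | i \in r])//.
apply: uniq_perm => //; first exact: filter_uniq.
by move=> i; rewrite mem_filter; case ir: (i \in r) => //=; rewrite rs.
Qed.

(** The integers from -N to N: [Negz k] is -(k + 1), so the second half runs from -1 to -N. *)
Definition int_ball (N : nat) : seq int := map Posz (iota 0 N.+1) ++ map Negz (iota 0 N).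

Lemma int_ball_uniq N : uniq (int_ball N).
Proof.
rewrite cat_uniq !map_inj_uniq ?iota_uniq => [|? ? []|? ? []]//=; rewrite andbT.
by apply/hasPn => _ /mapP[k _ ->]; apply/mapP => -[].
Qed.

Lemma mem_int_ball N (z : int) : (`|z| <= N)%N -> z \in int_ball N.
Proof.
rewrite mem_cat; case: z => k; rewrite ?absz_nat => kN; apply/orP; [left|right];
  by apply: map_f; rewrite mem_iota.
Qed.

Lemma int_ball_theta {R : realType} (t : R) N :
  \sum_(z <- int_ball N) expR (- (t * (z%:~R) ^+ 2)) =
  1 + 2 * \sum_(k < N) expR (- (t * k.+1%:R ^+ 2)).
Proof.
rewrite big_cat/= big_cons !big_map mulr0z expr0n/= mulr0 oppr0 expR0.
rewrite (iotaDl 1 0) big_map -addrA; congr (_ + _).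
rewrite -(big_mkord xpredT (fun k => expR (- (t * k.+1%:R ^+ 2)))) /index_iota subn0.
rewrite mulr_natl mulr2n; congr (_ + _); apply: eq_bigr => k _.
by rewrite NegzE mulrNz sqrrN.
Qed.

Lemma sqnormE {R : realType} (n : int * int) :
  (sqnorm n)%:~R = n.1%:~R ^+ 2 + n.2%:~R ^+ 2 :> R.
Proof. by rewrite /sqnorm intrD !rmorphXn. Qed.

(** The origin, which contributes 1, and X lie in a square of lattice points, over which the sum
    factors into the square of a partial theta sum. *)
Lemma lattice_theta_le {R : realType} (t : R) (X : seq (int * int)) :
  0 < t -> uniq X -> (0, 0) \notin X ->
  \sum_(n <- X) expR (- ((sqnorm n)%:~R * t)) + expR (- t) / 100 <= pi / t.
Proof.
move=> t0 uX X0.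
pose N := \max_(n <- X) maxn `|n.1| `|n.2|.
have XN n : n \in X -> (`|n.1| <= N)%N && (`|n.2| <= N)%N.
  move=> nX; rewrite -geq_max.
  exact: (@leq_bigmax_seq _ X xpredT (fun n : int * int => maxn `|n.1| `|n.2|)).
pose L := [seq (i, j) | i <- int_ball N, j <- int_ball N].
have : \sum_(n <- (0, 0) :: X) expR (- ((sqnorm n)%:~R * t)) <=
   \sum_(n <- L) expR (- ((sqnorm n)%:~R * t)).
  apply: ler_sum_subseq => [|||n]; last exact: expR_ge0.
  - by rewrite /= X0.
  - by apply: allpairs_uniq; rewrite ?int_ball_uniq// => -[? ?] [].
  - move=> n; rewrite in_cons => /predU1P[->|/XN /andP[n1 n2]].
      by apply/allpairsP; exists (0, 0); rewrite /= !mem_int_ball.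
    by apply/allpairsP; exists n; rewrite !mem_int_ball//; case: (n).
rewrite big_cons {1}/sqnorm/= mul0r oppr0 expR0.
have -> : \sum_(n <- L) expR (- ((sqnorm n)%:~R * t)) =
   (\sum_(z <- int_ball N) expR (- (t * (z%:~R) ^+ 2))) ^+ 2.
  rewrite big_allpairs expr2 mulr_suml; apply: eq_bigr => i _.
  rewrite mulr_sumr; apply: eq_bigr => j _.
  by rewrite -expRD sqnormE/=; congr expR; ring.
by rewrite int_ball_theta; have := theta_le t N t0; lra.
Qed.

(** This is [laplace_le] for q = p - 1, k = pi and s = m^2; its hypothesis is [lattice_theta_le]
    multiplied by e^(-m^2 t). *)
Lemma lattice_sum_le {R : realType} (p m : R) (X : seq (int * int)) :
  1 < p -> 0 < m -> uniq X -> (0, 0) \notin X ->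
  \sum_(n <- X) 1 / (m ^+ 2 + (sqnorm n)%:~R) `^ p <=
    pi / ((p - 1) * m `^ (2 * (p - 1))) - (m ^+ 2 + 1) `^ (- p) / 100.
Proof.
move=> p1 m0 uX X0.
have q0 : 0 < p - 1 by rewrite subr_gt0.
have s0 : 0 < m ^+ 2 by exact: exprn_gt0.
(* The extra pair of weight 1/100 encodes e^(-t) / 100 and produces the gap subtracted on the
   right. *)
have := laplace_le (p - 1) pi (m ^+ 2)
  ((1 / 100, m ^+ 2 + 1) :: [seq (1, m ^+ 2 + (sqnorm n)%:~R) | n <- X]) q0 s0.
rewrite subrK big_cons big_map /=.
have -> : \sum_(n <- X) 1 / (m ^+ 2 + (sqnorm n)%:~R) `^ p =
  \sum_(j <- X) 1 * (m ^+ 2 + (sqnorm j)%:~R) `^ (- p).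
  by apply: eq_bigr => n _; rewrite powRN.
have -> : pi / ((p - 1) * m `^ (2 * (p - 1))) = pi / (p - 1) * (m ^+ 2) `^ (- (p - 1)).
  by rewrite powRN -powR_mulrn ?ltW// -powRrM invfM mulrA.
move=> H; rewrite lerBrDl [_ / 100]mulrC -[100^-1]mul1r; apply: H.
  move=> x; rewrite in_cons => /predU1P[->|/mapP[n _ ->]]/=; first by rewrite addr_gt0.
  by rewrite ltr_pwDl// sqnormE addr_ge0 ?sqr_ge0.
move=> t t0; rewrite big_cons big_map/=.
have -> : \sum_(j <- X) 1 * expR (- ((m ^+ 2 + (sqnorm j)%:~R) * t)) =
    expR (- (m ^+ 2 * t)) * \sum_(n <- X) expR (- ((sqnorm n)%:~R * t)).
  rewrite mulr_sumr; apply: eq_bigr => n _.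
  by rewrite mul1r -expRD; congr expR; ring.
have -> : expR (- ((m ^+ 2 + 1) * t)) = expR (- (m ^+ 2 * t)) * expR (- t).
  by rewrite -expRD; congr expR; ring.
have := lattice_theta_le t X t0 uX X0.
move=> /(ler_wpM2l (expR_ge0 (- (m ^+ 2 * t)))).
by lra.
Qed.

Theorem proposition5p1 (R : realType) (p m : R) (hp : 1 < p) (hm : 0 <= m) :
  (I_p p m < 1%:E)%E.
Proof.
have q0 : 0 < p - 1 by rewrite subr_gt0.
rewrite /I_p; move: hm; rewrite le_eqVlt => /predU1P[<-|m0].
  (* At m = 0 the prefactor vanishes because 2 (p - 1) > 0, and 0 times any extended real is 0. *)
  by rewrite powR0 ?mulr0 ?mul0r ?mul0e ?lte_fin ?gt_eqF ?mulr_gt0.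
set c := (p - 1) * _ / pi.
have c0 : 0 < c by rewrite divr_gt0 ?pi_gt0// mulr_gt0 ?powR_gt0.
set eta := (m ^+ 2 + 1) `^ (- p) / 100.
have eta0 : 0 < eta by rewrite divr_gt0// powR_gt0// addr_gt0 ?exprn_gt0.
(* As [eta] is the same for all finite sets, the bound passes to the supremum, and c (c^-1 - eta) =
   1 - c eta < 1. *)
apply: (@le_lt_trans _ _ (c%:E * (c^-1 - eta)%:E)%E).
  apply: lee_wpmul2l; first by rewrite lee_fin ltW.
  apply: ge_ereal_sup => /= _ [A [finA AZ] <-].
  rewrite fsbig_finite// sumEFin lee_fin.
  have -> : c^-1 = pi / ((p - 1) * m `^ (2 * (p - 1))) by rewrite /c invf_div.
  apply: lattice_sum_le => //; first exact: finmap.fset_uniq.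
  by apply/negP => H; have := AZ (0, 0); move: H; rewrite in_fset_set// inE => H /(_ H).
rewrite -EFinM lte_fin mulrBr divff ?gt_eqF// ltrBlDr ltrDl.
exact: mulr_gt0.
Qed.
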